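(* Let $\ell\in\mathbb{N}_0$ and let $a,b\in\mathbb{R}$ with $a\le b$. If $f_{\ell}(x) = {}_{\ell}D_M^{(x)}\left[F_{\ell}(x)\right]$, where $F_{\ell}(x)$ is of the form $\sum_{n=0}^{\infty} a_{n,\ell}\, x^n$ on $[a,b]$, then $$\int_{(\ell,a)}^{b} f_{\ell}(t)\,dt = F_{\ell}(b) - F_{\ell}(a).$$
   Context: $\mathbb{N}_0$ is the set of non-negative integers, and $(\alpha)_m=\alpha(\alpha+1)\cdots(\alpha+m-1)$ is the Pochhammer symbol, with $(\alpha)_0=1$. **Derivative operator.** Let $\theta = z\frac{d}{dz}$. For $p\in\mathbb{N}_0$, $\alpha\in\mathbb{C}$ and $f(z)=\sum_{n\ge 1} a_n z^n$, put ${}_p\Delta_{\alpha}^{\theta}(f(z)) = \sum_{n\ge1} a_n\, (\alpha)_{n-1}^p\, (\theta+\alpha-1)^{pn}(z^n)$ if $p\ge 1$, and ${}_0\Delta_{\alpha}^{\theta}(f)=f$. Here $(\theta+\alpha)^r$ means $r$-fold composition. For $f(z)=\sum_{n\ge0}a_nz^n$, define ${}_pD_M^{(z)}[f(z)] = z^{-1}\,{}_p\Delta_1^{\theta}(\theta f(z))$. Explicitly, ${}_{\ell}D_M^{(x)}\left[\sum_{n\ge0} a_n x^n\right] = \sum_{n\ge 1} [n]_{\ell}\, a_n x^{n-1}$, where $[n]_{\ell} = n^{\ell n+1}((n-1)!)^{\ell}$ for $n\ge1$. **Integral operator.** For $p,\delta\in\mathbb{N}_0$, $\alpha \in\mathbb{C}$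 with $\alpha\ne 0,-1,-2,\dots$ and $\alpha\ne-\delta n$ for $n\in\mathbb{N}_0$, define $${}_p\nabla_{\alpha}^{\delta}\left(\sum_{n=0}^{\infty}a_{n,p}\,x^{\delta n}\right)=\sum_{n=0}^{\infty}\frac{a_{n,p}}{(\alpha)_{\delta n}^p\,(\delta n+\alpha)^{p(\delta n+1)}}\,x^{\delta n}\quad (p\ge1),$$ and let ${}_0\nabla_\alpha^\delta$ be the identity. For $f_p(x)=\sum_{n\ge0}a_{n,p}\,x^{\delta n}$, put $\Lambda(f_p(x))=x^{-1}\int f_p(x)\,dx$, where the indefinite integral is taken termwise with zero constant of integration, i.e. $\Lambda(f_p(x))=\sum_{n\ge0}\frac{a_{n,p}}{\delta n+1}x^{\delta n}$. The $p$-integral from $a$ to $b$ ($a\le b$ real) is $$\int_{(p,a)}^{b}f_p(x)\,dx=\left[x\;{}_p\nabla_1^{\delta}\left(\Lambda(f_p(x))\right)\right]_a^b = b\;{}_p\nabla_1^{\delta}(\Lambda(f_p(b))) - a\;{}_p\nabla_1^{\delta}(\Lambda(f_p(a))).$$ In the claim, $p=\ell$ and $\delta=1$. *)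

(* Defs.v *)
From Stdlib Require Import Reals.
From Coquelicot Require Import Coquelicot.

Local Open Scope C_scope.

(* Formal power series with complex coefficients: [c n] is the coefficient of
   z^n.  The operators below act on formal series, as in their termwise
   definition; no convergence is involved. *)
Definition fps := nat -> C.

Fixpoint poch (alpha : C) (m : nat) : C :=
  match m with
  | O => 1
  | S k => poch alpha k * (alpha + INR k)
  end.

Definition monomial (n : nat) : fps := fun k => if Nat.eqb k n then 1 else 0.

Definition theta (c : fps) : fps := fun n => INR n * c n.

Definition theta_plus (beta : C) (c : fps) : fps :=
  fun n => theta c n + beta * c n.

(* The n-th summand is a multiple of z^n, so the formal sum over n >= 1 is
   locally finite: only the summands with n <= k can reach the coefficient of
   z^k. *)
Definition Delta_theta (p : nat) (alpha : C) (c : fps) : fps :=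
  match p with
  | O => c
  | S _ => fun k =>
      sum_n_m (fun n => c n * poch alpha (n - 1) ^ p *
        Nat.iter (p * n) (theta_plus (alpha - 1)) (monomial n) k) 1 k
  end.

(* Multiplication by z^{-1}; meaningful when the constant term is zero. *)
Definition div_z (c : fps) : fps := fun n => c (S n).

Definition DM (p : nat) (c : fps) : fps := div_z (Delta_theta p 1 (theta c)).

(* In [nabla], [Lambda] and [is_p_integral], [c n] is the coefficient of
   x^(delta * n). *)
Definition nabla (p delta : nat) (alpha : C) (c : nat -> C) : nat -> C :=
  match p with
  | O => c
  | S _ => fun n =>
      c n / (poch alpha (delta * n) ^ p *
             (INR (delta * n) + alpha) ^ (p * (delta * n + 1)))
  end.

Definition Lambda (delta : nat) (c : nat -> C) : nat -> C :=
  fun n => c n / (INR (delta * n) + 1).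

Definition is_dseries (delta : nat) (c : nat -> C) (x : R) (s : C) : Prop :=
  is_series (V := C_NormedModule) (fun n => c n * RtoC x ^ (delta * n)) s.

(* The p-integral from a to b exists and equals v. *)
Definition is_p_integral (p delta : nat) (c : nat -> C) (a b : R) (v : C)
  : Prop :=
  exists sa sb : C,
    is_dseries delta (nabla p delta 1 (Lambda delta c)) a sa /\
    is_dseries delta (nabla p delta 1 (Lambda delta c)) b sb /\
    v = RtoC b * sb - RtoC a * sa.

(* Main.v *)
(* Termwise, [nabla l 1 1 (Lambda 1 (DM l A))] is the shift n |-> A (n + 1),
   since the weights of the derivative and of the integral cancel.  Multiplied
   by x, the shifted series sums to F x - A 0, and the constant A 0 disappears
   in the difference between the two endpoints. *)
Require Import Defs.
From Stdlib Require Import Reals Lia.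
From Coquelicot Require Import Coquelicot.

Local Open Scope C_scope.

Lemma INR_S_neq_0 (n : nat) : RtoC (INR (S n)) <> 0.
Proof.
  intros H; apply RtoC_inj in H; exact (not_0_INR (S n) (Nat.neq_succ_0 n) H).
Qed.

Lemma INR_S_C (n : nat) : RtoC (INR (S n)) = RtoC (INR n) + 1.
Proof. now rewrite S_INR, RtoC_plus. Qed.

Lemma poch1_neq_0 (n : nat) : poch 1 n <> 0.
Proof.
  induction n as [|n IH]; simpl poch.
  - exact C1_nz.
  - apply Cmult_neq_0; [exact IH|].
    rewrite Cplus_comm, <- INR_S_C; apply INR_S_neq_0.
Qed.

(** With [alpha = 1] the shift [alpha - 1] vanishes, leaving the operator [theta], which is diagonal
    on monomials. *)
Lemma iter_theta (N : nat) (c : fps) (k : nat) :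
  Nat.iter N (theta_plus (1 - 1)) c k = RtoC (INR k) ^ N * c k.
Proof.
  induction N as [|N IH]; simpl Nat.iter.
  - simpl; ring.
  - unfold theta_plus at 1, theta; rewrite IH, Cpow_S; ring.
Qed.

(** Powers of [theta] keep each monomial in its own degree, so only the top summand reaches degree
    [S n]. For [p = 0] both weights are empty powers, so one formula covers the two branches of the
    definition. *)
Lemma Delta_theta_1_coef (p : nat) (c : fps) (n : nat) :
  Delta_theta p 1 c (S n)
  = c (S n) * poch 1 n ^ p * RtoC (INR (S n)) ^ (p * S n).
Proof.
  destruct p as [|p].
  - simpl; ring.
  - unfold Delta_theta; rewrite sum_n_Sm by lia.
    rewrite (sum_n_m_ext_loc _ (fun _ => zero)).
    + rewrite sum_n_m_const_zero, plus_zero_l, iter_theta.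
      unfold monomial; rewrite Nat.eqb_refl.
      replace (S n - 1)%nat with n by lia.
      match goal with |- ?x = ?y => change (@eq C x y) end; ring.
    + intros k Hk; rewrite iter_theta.
      unfold monomial; destruct (Nat.eqb_spec (S n) k); [lia|].
      match goal with |- ?x = _ => change (@eq C x 0) end; ring.
Qed.

Lemma nabla_1_coef (p delta : nat) (c : nat -> C) (n : nat) :
  nabla p delta 1 c n
  = c n / (poch 1 (delta * n) ^ p *
           RtoC (INR (S (delta * n))) ^ (p * S (delta * n))).
Proof.
  destruct p as [|p].
  - simpl; field.
  - unfold nabla; rewrite Nat.add_1_r, INR_S_C; reflexivity.
Qed.

(** The factor [n + 1] from [theta] cancels the divisor in [Lambda], and the weight of [Delta_theta]
    in degree [n + 1] is exactly the denominator of [nabla] at index [n]. *)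
Lemma nabla_Lambda_DM (p : nat) (c : fps) (n : nat) :
  nabla p 1 1 (Lambda 1 (DM p c)) n = c (S n).
Proof.
  rewrite nabla_1_coef; unfold Lambda, DM, div_z.
  rewrite Delta_theta_1_coef, !Nat.mul_1_l, <- INR_S_C.
  unfold theta.
  field; repeat split; auto using Cpow_nz, INR_S_neq_0, poch1_neq_0.
Qed.

Lemma pow_n_Cpow (x : C) (n : nat) : pow_n (K := C_AbsRing) x n = x ^ n.
Proof.
  induction n as [|n IH]; [reflexivity|].
  rewrite Cpow_S, <- IH; reflexivity.
Qed.

(* At x = 0 the shifted series has to be summed separately: its value A 1
   cannot be recovered from the value of the original series. *)
Lemma is_pseries_shift (A : nat -> C) (x v : C) :
  is_pseries (K := C_AbsRing) (V := C_NormedModule) A x v ->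
  exists s : C,
    is_pseries (K := C_AbsRing) (V := C_NormedModule)
      (fun n => A (S n)) x s /\ x * s = v - A 0%nat.
Proof.
  intros H.
  destruct (Ceq_dec x 0) as [->|Hx].
  - exists (A 1%nat); split.
    + exact (is_pseries_0 (fun n => A (S n))).
    + rewrite (filterlim_locally_unique _ _ _ H (is_pseries_0 A)).
      change (@zero C_AbsRing) with (RtoC 0); ring.
  - exists ((v - A 0%nat) / x); split.
    + replace ((v - A 0%nat) / x) with
        (scal (K := C_AbsRing) (V := C_NormedModule) (/ x)
           (plus v (opp (A 0%nat)))).
      * exact (is_pseries_decr_1 A x (/ x) v (Cinv_l x Hx) H).
      * unfold scal, plus, opp; simpl; unfold mult; simpl; field; exact Hx.
    + field; exact Hx.
Qed.

Theorem theorem2p3 (l : nat) (a b : R) (hab : (a <= b)%R)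
    (A : nat -> C) (F : R -> C) (f : fps)
    (hF : forall x : R, (a <= x <= b)%R ->
       is_pseries (K := C_AbsRing) (V := C_NormedModule) A (RtoC x) (F x))
    (hf : f = DM l A) :
  is_p_integral l 1 f a b (F b - F a)%C.
Proof.
  assert (H : forall x : R, (a <= x <= b)%R -> exists s : C,
    is_dseries 1 (nabla l 1 1 (Lambda 1 f)) x s /\
    RtoC x * s = F x - A 0%nat).
  { intros x Hx.
    destruct (is_pseries_shift A x (F x) (hF x Hx)) as [s [Hs E]].
    exists s; split; [|exact E].
    unfold is_dseries; eapply is_series_ext; [|exact Hs].
    intros n; rewrite hf, nabla_Lambda_DM, Nat.mul_1_l.
    (* [is_pseries] scales each coefficient by the power on the left, while [is_dseries] has the
       power on the right. *)
    simpl; rewrite pow_n_Cpow; apply Cmult_comm. }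
  destruct (H a) as [sa [Ha Ea]]; [split; [apply Rle_refl|exact hab]|].
  destruct (H b) as [sb [Hb Eb]]; [split; [exact hab|apply Rle_refl]|].
  exists sa, sb; repeat split; [exact Ha|exact Hb|].
  rewrite Ea, Eb; ring.
Qed.
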